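(* Let $(A,\cdot)$ be an associative algebra over a field $K$ with a left or right unit, and let $*$ be an associative product on $A$. Then the following are equivalent: (i) $*$ is $(12)$-matching with $\cdot$; (ii) $*$ is totally compatible with $\cdot$.
   Context: All algebras and vector spaces are over a field $K$ and all products are binary and bilinear. A left (resp. right) unit of $(A,\cdot)$ is an element $e\in A$ with $e\cdot a=a$ (resp. $a\cdot e=a$) for all $a\in A$. An associative product $*$ on $A$ is $(12)$-matching with $\cdot$ if $(a*b)\cdot c=a\cdot(b*c)$ and $(a\cdot b)*c=a*(b\cdot c)$ for all $a,b,c\in A$; it is totally compatible with $\cdot$ if $(a*b)\cdot c=(a\cdot b)*c=a*(b\cdot c)=a\cdot(b*c)$ for all $a,b,c\in A$. *)

(* Defs.v *)
From mathcomp Require Import all_boot all_order all_algebra.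

Set Implicit Arguments.
Unset Strict Implicit.
Unset Printing Implicit Defensive.

(* In both predicates, [dot] stands for the given product and [star] for the
   second one; associativity and bilinearity of the two products are not part
   of the predicates. *)

Definition matching12 (A : Type) (dot star : A -> A -> A) : Prop :=
  forall a b c : A,
    dot (star a b) c = dot a (star b c) /\ star (dot a b) c = star a (dot b c).

Definition totally_compatible (A : Type) (dot star : A -> A -> A) : Prop :=
  forall a b c : A,
    [/\ dot (star a b) c = star (dot a b) c,
        star (dot a b) c = star a (dot b c)
      & star a (dot b c) = dot a (star b c)].

(* Main.v *)
Require Import Defs.
From mathcomp Require Import all_boot all_order all_algebra.

Local Open Scope ring_scope.

(** Write [.] for the given product and [*] for the second one.  A one-sided
    unit [e] forces a matching product to be [.] twisted by the single element
    [z = e * e]: moving [e] across the identity [(a * b) . c = a . (b * c)]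
    yields [a * b = z . a . b] when [e] is a left unit, and [a * b = a . b . z]
    when [e] is a right unit.  The identity that total compatibility adds,
    [(a * b) . c = (a . b) * c], then holds by associativity of [.]: for a left
    unit both sides equal [z . a . b . c]; for a right unit, replace the left
    side by [a . (b * c)], and both sides equal [a . b . c . z]. *)

(** [a * b = e . (a * b) = (e * a) . b], and likewise [e * a = (e * e) . a]. *)
Lemma matching_left_unitE (A : Type) (dot star : A -> A -> A) (e : A) :
  left_id e dot ->
  (forall a b c, dot (star a b) c = dot a (star b c)) ->
  forall a b, star a b = dot (dot (star e e) a) b.
Proof. by move=> e_dot match1 a b; rewrite match1 e_dot match1 e_dot. Qed.

(** [a * b = (a * b) . e = a . (b * e)], and likewise [b * e = b . (e * e)]. *)
Lemma matching_right_unitE (A : Type) (dot star : A -> A -> A) (e : A) :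
  right_id e dot ->
  (forall a b c, dot (star a b) c = dot a (star b c)) ->
  forall a b, star a b = dot a (dot b (star e e)).
Proof. by move=> dot_e match1 a b; rewrite -match1 dot_e -match1 dot_e. Qed.

Lemma matching_mixed_assoc (A : Type) (dot star : A -> A -> A) :
  associative dot ->
  (exists e, left_id e dot) \/ (exists e, right_id e dot) ->
  (forall a b c, dot (star a b) c = dot a (star b c)) ->
  forall a b c, dot (star a b) c = star (dot a b) c.
Proof.
move=> dotA [[e e_dot]|[e dot_e]] match1 a b c.
  have starE := matching_left_unitE _ _ _ _ e_dot match1.
  by rewrite (starE a b) (starE (dot a b) c) !dotA.
have starE := matching_right_unitE _ _ _ _ dot_e match1.
by rewrite match1 (starE b c) (starE (dot a b) c) !dotA.
Qed.

Theorem proposition3p2 (K : fieldType) (A : lmodType K)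
    (dot star : {bilinear A -> A -> A})
    (dotA : associative dot) (starA : associative star)
    (dot_unit : (exists e : A, left_id e dot) \/ (exists e : A, right_id e dot)) :
  matching12 dot star <-> totally_compatible dot star.
Proof.
split=> [match12 a b c | compat a b c].
  have match1 x y z := proj1 (match12 x y z).
  have match2 x y z := proj2 (match12 x y z).
  have mixed := matching_mixed_assoc _ _ _ dotA dot_unit match1.
  by split; [exact: mixed | exact: match2 | rewrite -match2 -mixed match1].
have [dot_star star_dot star_dotr] := compat a b c.
by split; rewrite // dot_star star_dot.
Qed.
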